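(* Let $P$ be a regular power series method and let $X$ be a compact Hausdorff space with at least two points. Let $\psi_1,\dots,\psi_d\in C(X)$ and suppose there exist $g_1,\dots,g_d\in C(X)$ such that the functions $\breve{Q}_x(y)=\sum_{\lambda=1}^d g_\lambda(x)\psi_\lambda(y)$ satisfy, for all $x,y\in X$, $\breve{Q}_x(y)\ge 0$, and $\breve{Q}_x(y)=0$ if and only if $y=x$. Let $(T_j)_{j\in\mathbb{N}_0}$ be a sequence of positive linear operators from $C(X)$ into itself with $T_0(\psi)=0$ for all $\psi\in C(X)$, such that $$st_P-\lim_{j\to\infty}\|T_j(\psi_\lambda)-\psi_\lambda\|=0\qquad\text{for }\lambda=1,2,\dots,d.$$ Then for all $\psi\in C(X)$, $$st_P-\lim_{j\to\infty}\|T_j(\psi)-\psi\|=0.$$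
   Context: $\mathbb{N}_0$ is the set of non-negative integers. A power series method $P=(s_j)_{j\ge0}$ is a real sequence with $s_0>0$ and $s_1,s_2,\dots\ge 0$ such that the power series $s(t)=\sum_{j=0}^\infty s_jt^j$ has radius of convergence $R$ with $0<R\le\infty$. It is regular if and only if $\lim_{0<t\to R^-}\frac{s_jt^j}{s(t)}=0$ for every $j\in\mathbb{N}_0$. For $E\subset\mathbb{N}_0$, the $P$-density of $E$ is $\delta_P(E)=\lim_{0<t\to R^-}\frac{1}{s(t)}\sum_{j\in E}s_jt^j$, whenever this limit exists. A real sequence $(x_j)$ is $P$-statistically convergent to $L$, written $st_P-\lim_{j\to\infty}x_j=L$, if for every $\varepsilon>0$, $\delta_P(\{j\in\mathbb{N}_0:|x_j-L|\ge\varepsilon\})=0$. $C(X)$ is the Banach space of real-valued continuous functions on $X$ with norm $\|\psi\|=\sup_{x\in X}|\psi(x)|$. A linear operator is positive if it maps non-negative functions to non-negative functions. *)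

(* Defs.v *)
From HB Require Import structures.
From mathcomp Require Import all_boot all_order all_algebra.
From mathcomp Require Import all_classical all_reals all_analysis.

Set Implicit Arguments.
Unset Strict Implicit.
Unset Printing Implicit Defensive.

Import Order.TTheory GRing.Theory Num.Theory.
Import numFieldNormedType.Exports.

Local Open Scope classical_set_scope.
Local Open Scope ring_scope.

Section continuous_functions.
Context {X : topologicalType} {R : realType}.
Implicit Types f g h : continuousType X R.

Let zero : continuousType X R := cst 0.

Let addcts_subproof f g : continuous (fun x => f x + g x).
Proof. by move=> x; apply: cvgD; apply: cts_fun. Qed.

Let oppcts_subproof f : continuous (fun x => - f x).
Proof. by move=> x; apply: cvgN; apply: cts_fun. Qed.

Let scalects_subproof (a : R) f : continuous (fun x => a * f x).
Proof. by move=> x; apply: cvgM; [exact: cvg_cst | apply: cts_fun]. Qed.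

Let add f g : continuousType X R := mkcts (@addcts_subproof f g).
Let opp f : continuousType X R := mkcts (@oppcts_subproof f).
Let scale (a : R) f : continuousType X R := mkcts (@scalects_subproof a f).

Let addA : associative add.
Proof. by move=> f g h; apply/continuousEP => x; exact: addrA. Qed.
Let addC : commutative add.
Proof. by move=> f g; apply/continuousEP => x; exact: addrC. Qed.
Let add0 : left_id zero add.
Proof. by move=> f; apply/continuousEP => x; exact: add0r. Qed.
Let addN : left_inverse zero opp add.
Proof. by move=> f; apply/continuousEP => x; exact: addNr. Qed.

HB.instance Definition _ :=
  GRing.isZmodule.Build (continuousType X R) addA addC add0 addN.

Let scaleA a b f : scale a (scale b f) = scale (a * b) f.
Proof. by apply/continuousEP => x; exact: mulrA. Qed.
Let scale1 : left_id 1 scale.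
Proof. by move=> f; apply/continuousEP => x; exact: mul1r. Qed.
Let scaleDr : right_distributive scale +%R.
Proof. by move=> a f g; apply/continuousEP => x; exact: mulrDr. Qed.
Let scaleDl f : {morph scale^~ f : a b / a + b}.
Proof. by move=> a b; apply/continuousEP => x; exact: mulrDl. Qed.

HB.instance Definition _ :=
  GRing.Zmodule_isLmodule.Build R (continuousType X R)
    scaleA scale1 scaleDr scaleDl.

Lemma cts0E x : (0 : continuousType X R) x = 0. Proof. by []. Qed.
Lemma ctsDE f g x : (f + g) x = f x + g x. Proof. by []. Qed.
Lemma ctsNE f x : (- f) x = - f x. Proof. by []. Qed.
Lemma ctsBE f g x : (f - g) x = f x - g x. Proof. by []. Qed.
Lemma ctsZE (a : R) f x : (a *: f) x = a * f x. Proof. by []. Qed.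

Definition sup_norm f : R := sup (range (fun x => `|f x|)).

Definition positive_operator (T : continuousType X R -> continuousType X R) :=
  forall f, (forall x, 0 <= f x) -> forall x, 0 <= T f x.

End continuous_functions.

Section power_series_methods.
Context {R : realType}.
Implicit Types (s : R^nat) (E : set nat) (x : R^nat).

Definition radius_of_convergence s : \bar R :=
  ereal_sup [set `|t|%:E | t in [set t : R | cvgn (pseries s t)]].

Definition power_series_method s : Prop :=
  [/\ 0 < s 0%N, forall j, (0 < j)%N -> 0 <= s j &
      (0 < radius_of_convergence s)%E].

(* Real t tending to r with 0 < t < r.  Taking neighbourhoods of r in \bar R
   treats finite r and r = +oo alike; [fine] only reads off the real t. *)
Definition left_of (r : \bar R) : set_system R :=
  fine @ within [set u | (0 < u < r)%E] (nbhs r).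

Definition power_series_sum s (t : R) : R := limn (pseries s t).

Definition regular s : Prop :=
  forall j, s j * t ^+ j / power_series_sum s t
    @[t --> left_of (radius_of_convergence s)] --> 0.

Definition has_density s E (d : R) : Prop :=
  (power_series_sum s t)^-1 * limn (fun n => \sum_(0 <= j < n | j \in E) s j * t ^+ j)
    @[t --> left_of (radius_of_convergence s)] --> d.

Definition stat_cvg s x (L : R) : Prop :=
  forall e : R, 0 < e -> has_density s [set j | e <= `|x j - L|] 0.

End power_series_methods.

(* Main.v *)
(* Write q_x(y) for the kernel and p = q_a + q_b > 0 with a <> b.  The function
   |p(x) f(y) - f(x) p(y)| vanishes on the diagonal, so by compactness of X * X
   it is at most eta p(x) p(y) + C q_x(y).  Applying T at x, and using that p
   and the q_x are combinations of the psi_l with q_x(x) = 0, one gets for each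
   e > 0 a delta > 0, independent of T, such that ||T psi_l - psi_l|| <= delta
   for all l implies ||T f - f|| < e.  Hence the set where ||T_j f - f|| >= e
   is covered by d sets of P-density zero. *)
Require Import Defs.
From HB Require Import structures.
From mathcomp Require Import all_boot all_order all_algebra.
From mathcomp Require Import all_classical all_reals all_analysis.
From mathcomp Require Import ring lra.

Import Order.TTheory GRing.Theory Num.Theory.
Import numFieldNormedType.Exports.

Local Open Scope classical_set_scope.
Local Open Scope ring_scope.

(** * Power series inside the radius of convergence, and sets of P-density zero *)

Lemma left_of_filter (R : realType) (r : \bar R) : Filter (left_of r).
Proof. by rewrite /left_of; apply: fmap_filter; apply: within_filter. Qed.

Lemma left_of_near (R : realType) (r : \bar R) :
  \forall t \near left_of r, 0 < t /\ (t%:E < r)%E.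
Proof.
apply: (@filterE _ (nbhs r)) => u /andP[u0 ur].
have ufin : u \is a fin_num.
  by rewrite ge0_fin_numE ?ltW// (lt_le_trans ur)// leey.
by rewrite /= -lte_fin fineK.
Qed.

Section zero_density.
Context {R : realType}.
Implicit Types (s : nat -> R) (E : set nat).

Lemma power_series_method_ge0 s : power_series_method s -> forall j, 0 <= s j.
Proof. by case=> s0 sj _ [|j]; [exact: ltW | exact: sj]. Qed.

Lemma pseries_cvg_inside s (t : R) :
  0 < t -> (t%:E < radius_of_convergence s)%E -> cvgn (pseries s t).
Proof.
move=> t0 /ereal_sup_gt [_ [x sx <-]]; rewrite lte_fin => tx.
by apply: (is_cvg_pseries_inside sx); rewrite gtr0_norm.
Qed.

Lemma is_cvgn_restrict (a : nat -> R) E : (forall j, 0 <= a j) ->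
  cvgn (series a) -> cvgn (fun n => \sum_(0 <= j < n | j \in E) a j).
Proof.
move=> a0 ca.
have -> : (fun n => \sum_(0 <= j < n | j \in E) a j) =
    series (fun j => if j \in E then a j else 0).
  by apply/funext => n; rewrite big_mkcond.
by apply: series_le_cvg ca => // n; case: ifP.
Qed.

(** Union bound: a term indexed by [E] is counted at least once on the right, and all other terms
    there are nonnegative. *)
Lemma restrict_sum_le (I : finType) (a : nat -> R) E (F : I -> set nat) n :
  (forall j, 0 <= a j) -> E `<=` \bigcup_i F i ->
  \sum_(0 <= j < n | j \in E) a j <=
  \sum_(i : I) \sum_(0 <= j < n | j \in F i) a j.
Proof.
move=> a0 EF.
rewrite (eq_bigr (fun i => \sum_(0 <= j < n) if j \in F i then a j else 0));
  last by move=> i _; rewrite big_mkcond.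
rewrite exchange_big /= big_mkcond; apply: ler_sum => j _.
case: ifPn => [/set_mem/EF[i _ Fij]|_].
  by rewrite (bigD1 i)//= mem_set// lerDl; apply: sumr_ge0 => k _; case: ifP.
by apply: sumr_ge0 => i _; case: ifP.
Qed.

(** Finite subadditivity: the ratio defining the density of [E] is squeezed between 0 and the finite
    sum of the ratios of the [F i], which tends to 0. *)
Lemma has_density0_cover s (I : finType) E (F : I -> set nat) :
  power_series_method s -> E `<=` \bigcup_i F i ->
  (forall i, has_density s (F i) 0) -> has_density s E 0.
Proof.
move=> Ps EF F0; rewrite /has_density.
have := @left_of_filter R (radius_of_convergence s) => FF.
have s_ge0 := power_series_method_ge0 s Ps.
pose D (A : set nat) (t : R) := (power_series_sum s t)^-1 *
  limn (fun n => \sum_(0 <= j < n | j \in A) s j * t ^+ j).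
apply: (@squeeze_cvgr _ _ FF R (cst 0) (fun t => \sum_i D (F i) t) (D E));
  last 2 first.
- exact: cvg_cst.
- have := @cvg_big R I _ 0 xpredT (@add_continuous R) _ _ (index_enum I)
    (fun i => D (F i)) (fun=> 0) FF (fun i _ => F0 i).
  by rewrite big1.
near=> t.
have [t0 tr] : 0 < t /\ (t%:E < radius_of_convergence s)%E.
  by near: t; exact: left_of_near.
pose a j := s j * t ^+ j.
have a0 j : 0 <= a j by rewrite mulr_ge0// exprn_ge0// ltW.
have ca : cvgn (series a) := pseries_cvg_inside s t t0 tr.
(* The limits compared below are values of [limn], which are meaningful only once convergence is
   known. *)
have cr (A : set nat) : cvgn (fun n => \sum_(0 <= j < n | j \in A) a j).
  exact: (is_cvgn_restrict a A a0 ca).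
have S0 : 0 <= (power_series_sum s t)^-1.
  rewrite invr_ge0; apply: limr_ge => //.
  by near=> n; apply: sumr_ge0 => j _; exact: a0.
apply/andP; split.
  apply: mulr_ge0 => //; apply: limr_ge => //.
  by near=> n; apply: sumr_ge0 => j _; exact: a0.
rewrite /D -mulr_sumr; apply: ler_wpM2l => //.
have csum : \sum_i (\sum_(0 <= j < n | j \in F i) a j) @[n --> \oo] -->
    \sum_i limn (fun n => \sum_(0 <= j < n | j \in F i) a j).
  by apply: (cvg_big (@add_continuous R)).
rewrite -(cvg_lim _ csum)//; apply: ler_lim => //.
- exact: cvgP csum.
- by near=> n; exact: restrict_sum_le.
Unshelve. all: by end_near. Qed.

End zero_density.

(** * The supremum norm on a compact space *)

Section sup_norm.
Context {R : realType} {X : topologicalType}.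
Hypothesis X_compact : compact [set: X].
Implicit Types f : continuousType X R.

Lemma ler_sup_norm f x : `|f x| <= sup_norm f.
Proof.
apply: ub_le_sup; last by exists x.
have cf : compact (range f).
  by apply: continuous_compact => //; apply: continuous_subspaceT; exact: cts_fun.
have [M [_ fM]] := compact_bounded cf.
exists (M + 1) => _ [y _ <-]; apply: fM; first by rewrite ltrDl.
by exists y.
Qed.

(** The point [x0] makes the range nonempty; the supremum of the empty set is 0 by convention, which
    would break the bound for negative [e]. *)
Lemma sup_norm_ler f (x0 : X) e : (forall x, `|f x| <= e) -> sup_norm f <= e.
Proof.
move=> fe; apply: ge_sup; first by exists `|f x0|, x0.
by move=> _ [x _ <-].
Qed.

Lemma cts_sumE (I : Type) (r : seq I) (F : I -> continuousType X R) x :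
  (\sum_(i <- r) F i) x = \sum_(i <- r) F i x.
Proof. by apply: (big_morph (fun f : continuousType X R => f x)). Qed.

End sup_norm.

(** * Domination by compactness, and positive operators *)

Lemma compact_dominated (R : realType) (Z : topologicalType) (u v : Z -> R) :
  compact [set: Z] -> continuous u -> continuous v ->
  (forall z, 0 <= v z) -> (forall z, v z = 0 -> u z < 0) ->
  exists2 C, 0 <= C & forall z, u z <= C * v z.
Proof.
move=> /compact_near_coveringP Zc cu cv v0 uv.
(* By compactness it suffices to find, around each [z], a neighbourhood and a threshold for [n]. If
   [v z = 0], then [u] stays negative nearby and any [n] works; otherwise [u] is locally below
   [|u z| + 1] and [v] above [v z / 2], and the threshold is the quotient of these bounds. *)
have : \forall n \near \oo, [set: Z] `<=` (fun z => u z <= n%:R * v z).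
  apply: Zc => z _.
  have [vz0|vz0] := eqVneq (v z) 0.
    exists ([set y | u y < 0], setT); first split => /=.
    - by apply: (cvgr_lt (u z) (cu z)); exact: uv.
    - exact: filterT.
    by move=> [y n] [/= uy _]; rewrite (le_trans (ltW uy))// mulr_ge0.
  have vz : 0 < v z by rewrite lt_def vz0 v0.
  exists ([set y | u y < `|u z| + 1 /\ v z / 2 < v y],
    [set n | 2 * (`|u z| + 1) / v z <= n%:R]); first split => /=.
  - apply: filterI.
      by apply: (cvgr_lt (u z) (cu z)); rewrite (le_lt_trans (ler_norm _))// ltrDl.
    by apply: (cvgr_gt (v z) (cv z)); lra.
  - exact: nbhs_infty_ger.
  move=> [y n] [/= [uy vy] nu]; apply: (le_trans (ltW uy)).
  have -> : `|u z| + 1 = 2 * (`|u z| + 1) / v z * (v z / 2) by field.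
  apply: ler_pM => //; last exact: ltW.
  - by rewrite divr_ge0 ?ltW// mulr_gt0// ltr_wpDl.
  - by rewrite divr_ge0 ?ltW.
by move=> [N _ /(_ N (leqnn N)) NP]; exists N%:R => // z; exact: NP.
Qed.

(** Both [k + h] and [k - h] are nonnegative, so their images are too. *)
Lemma positive_operator_norm_le (R : realType) (X : topologicalType)
    (T : {linear continuousType X R -> continuousType X R})
    (h k : continuousType X R) :
  positive_operator T -> (forall y, `|h y| <= k y) ->
  forall x, `|T h x| <= T k x.
Proof.
move=> T0 hk x; rewrite ler_norml.
have kDh : 0 <= T (k + h) x.
  by apply: T0 => y; have := hk y; rewrite ler_norml ctsDE; lra.
have kBh : 0 <= T (k - h) x.
  by apply: T0 => y; have := hk y; rewrite ler_norml ctsBE; lra.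
move: kDh kBh; rewrite linearD linearB ctsDE ctsBE; lra.
Qed.

Lemma cts_comp_fst (R : realType) (X Y : topologicalType)
  (h : continuousType X R) : continuous (fun z : X * Y => h z.1).
Proof. by move=> z; apply: (cvg_comp fst h); [exact: cvg_fst | exact: cts_fun]. Qed.

Lemma cts_comp_snd (R : realType) (X Y : topologicalType)
  (h : continuousType Y R) : continuous (fun z : X * Y => h z.2).
Proof. by move=> z; apply: (cvg_comp snd h); [exact: cvg_snd | exact: cts_fun]. Qed.

(** * The Korovkin estimate with an explicit tolerance on the test functions *)

Section quantitative_korovkin.
Context {R : realType} {X : topologicalType}.
Hypothesis X_compact : compact [set: X].
Context {d : nat} (psi g : 'I_d -> continuousType X R).

Let q (x : X) : continuousType X R := \sum_(l < d) g l x *: psi l.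

Let qE x y : q x y = \sum_(l < d) g l x * psi l y.
Proof. by rewrite cts_sumE. Qed.

Let G : R := \sum_(l < d) sup_norm (g l).

Let sup_norm_ge0 (x : X) (f : continuousType X R) : 0 <= sup_norm f.
Proof. exact: le_trans (normr_ge0 _) (ler_sup_norm X_compact f x). Qed.

(** [T] acts on the second variable with [x] frozen, so each [g l x] is a scalar and the errors on
    the [psi l] add up with total weight at most [G]. *)
Let q_approx (T : {linear continuousType X R -> continuousType X R}) (dlt : R) :
  (forall l, sup_norm (T (psi l) - psi l) <= dlt) ->
  forall x y, `|T (q x) y - q x y| <= G * dlt.
Proof.
move=> Tpsi x y; rewrite qE /q linear_sum cts_sumE -sumrB.
rewrite (le_trans (ler_norm_sum _ _ _))// mulr_suml; apply: ler_sum => l _.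
rewrite linearZ ctsZE -mulrBr normrM; apply: ler_pM => //.
  exact: ler_sup_norm.
exact: le_trans (ler_sup_norm X_compact (T (psi l) - psi l) y) (Tpsi l).
Qed.

Hypothesis q_ge0 : forall x y, 0 <= q x y.
Hypothesis q_eq0 : forall x y, q x y = 0 <-> y = x.

Lemma korovkin_modulus (a b : X) (f : continuousType X R) (e : R) :
  a <> b -> 0 < e -> exists2 dlt : R, 0 < dlt &
  forall T : {linear continuousType X R -> continuousType X R},
    positive_operator T ->
    (forall l, sup_norm (T (psi l) - psi l) <= dlt) ->
    sup_norm (T f - f) < e.
Proof.
(* [q a] vanishes only at [a] and [q b] only at [b], so [p] vanishes nowhere; it stands in for the
   constant 1 of the classical theorem. *)
move=> ab e0; have [p pE] : exists p, p = q a + q b by exists (q a + q b).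
have p_gt0 x : 0 < p x.
  rewrite pE lt_def ctsDE addr_ge0// andbT paddr_eq0//; apply/negP.
  by move=> /andP[/eqP/q_eq0 + /eqP/q_eq0 xb]; rewrite xb => /esym.
(* [K] encodes a positive lower bound [1 / K] of [p], from domination of the constant 1 by [p]. *)
have [K K0 pK] : exists2 K, 0 <= K & forall x, 1 <= K * p x.
  apply: (compact_dominated _ _ (cst 1) p) => //.
  - by move=> x; exact: cvg_cst.
  - exact: cts_fun.
  - by move=> x; exact: ltW.
  - by move=> x px; have := p_gt0 x; rewrite px ltxx.
pose B := sup_norm p; pose F := sup_norm f.
have B0 : 0 <= B by exact: sup_norm_ge0.
have F0 : 0 <= F by exact: sup_norm_ge0.
have G0 : 0 <= G by apply: sumr_ge0 => l _; exact: sup_norm_ge0.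
(* [B + 1] will bound [T p], so the [eta] term costs at most [p x * (e / 4)]. *)
pose eta := e / (4 * (B + 1)).
have eta0 : 0 < eta by rewrite divr_gt0// mulr_gt0// ltr_wpDl.
(* Subtracting the [eta] term makes [u] strictly negative on the diagonal, the zero set of the
   kernel, as [compact_dominated] requires. *)
pose u (z : X * X) := `|p z.1 * f z.2 - f z.1 * p z.2| - eta * p z.1 * p z.2.
have [C C0 uC] : exists2 C, 0 <= C & forall z, u z <= C * q z.1 z.2.
  apply: compact_dominated.
  - by rewrite -setXTT; exact: compact_setX.
  - move=> z; apply: cvgB.
      apply: cvg_norm; apply: cvgB; apply: cvgM;
        by [exact: cts_comp_fst | exact: cts_comp_snd].
    apply: cvgM; last exact: cts_comp_snd.
    by apply: cvgM; [exact: cvg_cst | exact: cts_comp_fst].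
  - have -> : (fun z : X * X => q z.1 z.2) =
        (fun z => \sum_(l < d) g l z.1 * psi l z.2).
      by apply/funext => z; exact: qE.
    move=> z; apply: (cvg_big (@add_continuous R)) => l _.
    by apply: cvgM; [exact: cts_comp_fst | exact: cts_comp_snd].
  - by move=> z; exact: q_ge0.
  move=> [x y] /= /q_eq0 ->.
  rewrite /u /= mulrC subrr normr0 sub0r oppr_lt0.
  exact: mulr_gt0 (mulr_gt0 eta0 (p_gt0 x)) (p_gt0 x).
(* [D] gathers the errors proportional to the tolerance [N^-1], with [K] paying for the factor
   [p x]. The summand [2 * G + 1] of [N] keeps [T p] within 1 of [p], and [4 * D / e] brings
   [D * N^-1] below [e / 4]. *)
pose D := K * (F * (2 * G) + C * G).
have D0 : 0 <= D by rewrite mulr_ge0// addr_ge0 ?mulr_ge0.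
pose N := 2 * G + 1 + 4 * D / e.
have N1 : 2 * G + 1 <= N by rewrite lerDl; apply: divr_ge0; [exact: mulr_ge0 | exact: ltW].
have N0 : 0 < N by lra.
exists N^-1; first by rewrite invr_gt0.
move=> T T0 Tpsi; have dlt0 : 0 < N^-1 by rewrite invr_gt0.
have Gdlt : 2 * G * N^-1 <= 1 by rewrite ler_pdivrMr// mul1r; lra.
have Ddlt : D * N^-1 <= e / 4.
  have De : e / 4 * (4 * D / e) = D by field; rewrite gt_eqF.
  by rewrite ler_pdivrMr// -[leLHS]De ler_pM2l ?divr_gt0// lerDr; lra.
have qTx x : T (q x) x <= G * N^-1.
  have := q_approx T _ Tpsi x x; rewrite (iffRL (q_eq0 x x) erefl) subr0.
  exact: le_trans (ler_norm _).
have pT x : `|T p x - p x| <= 2 * G * N^-1.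
  rewrite pE linearD !ctsDE opprD addrACA (le_trans (ler_normD _ _))//.
  have := q_approx T _ Tpsi a x; have := q_approx T _ Tpsi b x; lra.
(* Pointwise bounds pass to the supremum only as weak inequalities, so the target is [e / 2], made
   of two errors of [e / 4]. *)
apply: (@le_lt_trans _ _ (e / 2)); last by lra.
apply: (sup_norm_ler _ a) => x.
(* Multiplying by p x instead of dividing avoids the quotient f / p. *)
have main : `|p x * T f x - f x * T p x| <= eta * p x * T p x + C * T (q x) x.
  have : `|T (p x *: f - f x *: p) x| <= T ((eta * p x) *: p + C *: q x) x.
    apply: positive_operator_norm_le => // y.
    by have := uC (x, y); rewrite /u /= lerBlDl.
  by rewrite linearB linearD !linearZZ.
have Tp : T p x <= B + 1.
  have := ler_sup_norm X_compact p x; rewrite -/B.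
  have := pT x; rewrite !ler_norml; lra.
have fF := ler_sup_norm X_compact f x.
rewrite ctsBE -(ler_pM2l (p_gt0 x)).
have -> : p x * `|T f x - f x| = `|(p x * T f x - f x * T p x)
    + f x * (T p x - p x)|.
  by rewrite -{1}(gtr0_norm (p_gt0 x)) -normrM; congr `|_|; ring.
rewrite (le_trans (ler_normD _ _))// normrM.
have fp : `|f x| * `|T p x - p x| <= F * (2 * G * N^-1) by exact: ler_pM.
have etaTp : eta * p x * T p x <= p x * (e / 4).
  have -> : p x * (e / 4) = eta * p x * (B + 1).
    by rewrite /eta; field; rewrite gt_eqF// ltr_wpDl.
  by apply: ler_wpM2l => //; apply/ltW/mulr_gt0.
have CqT : C * T (q x) x <= C * (G * N^-1) by exact: ler_wpM2l.
have : F * (2 * G * N^-1) + C * (G * N^-1) <= p x * (e / 4).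
  apply: (@le_trans _ _ (p x * (D * N^-1))); last first.
    by apply: ler_wpM2l => //; exact: ltW.
  (* The factor [K * p x], which is at least 1, appears here and is then dropped. *)
  have -> : p x * (D * N^-1) =
      K * p x * (F * (2 * G * N^-1) + C * (G * N^-1)) by rewrite /D; ring.
  have dlt_ge0 := ltW dlt0.
  by rewrite ler_peMl// addr_ge0// !mulr_ge0.
lra.
Qed.

End quantitative_korovkin.

(** * From the uniform tolerance to statistical convergence *)

Theorem theorem3 (R : realType) (s : nat -> R)
    (P_method : power_series_method s) (P_regular : regular s)
    (X : topologicalType)
    (X_compact : compact [set: X]) (X_hausdorff : hausdorff_space X)
    (X_two_points : exists x y : X, x <> y)
    (d : nat) (psi : 'I_d -> continuousType X R)
    (exists_Q : exists g : 'I_d -> continuousType X R,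
      let Q (x y : X) := \sum_(l < d) g l x * psi l y in
      forall x y : X, 0 <= Q x y /\ (Q x y = 0 <-> y = x))
    (T : nat -> {linear continuousType X R -> continuousType X R})
    (T_positive : forall j, positive_operator (T j))
    (T0 : forall f, T 0%N f = 0)
    (T_psi : forall l : 'I_d,
      stat_cvg s (fun j => sup_norm (T j (psi l) - psi l)) 0) :
  forall f : continuousType X R,
    stat_cvg s (fun j => sup_norm (T j f - f)) 0.
Proof.
move=> f e e0; have [a [b ab]] := X_two_points; have [g gQ] := exists_Q.
have qE x y : (\sum_(l < d) g l x *: psi l) y = \sum_(l < d) g l x * psi l y.
  exact: cts_sumE.
have [dlt dlt0 Tdlt] : exists2 dlt : R, 0 < dlt &
    forall S : {linear continuousType X R -> continuousType X R},
    positive_operator S ->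
    (forall l, sup_norm (S (psi l) - psi l) <= dlt) -> sup_norm (S f - f) < e.
  apply: (korovkin_modulus X_compact psi g _ _ a b f e ab e0) => x y; rewrite qE.
    by have [] := gQ x y.
  by have [] := gQ x y.
have norm_id (h : continuousType X R) : `|sup_norm h - 0| = sup_norm h :> R.
  by rewrite subr0 ger0_norm// (le_trans _ (ler_sup_norm X_compact _ a)).
(* The covering sets are those where the error on [psi l] is at least [dlt]. An index outside all of
   them meets the tolerance for every [l], hence has error on [f] below [e]. *)
apply: (has_density0_cover s _ _ _ P_method _ (fun l => T_psi l dlt dlt0)) => j /=.
rewrite norm_id leNgt => /negP Tf.
apply: contrapT => nex; apply: Tf; apply: Tdlt => // l.
rewrite leNgt; apply/negP => ltl; apply: nex; exists l => //=.
by rewrite norm_id ltW.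
Qed.
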